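(* For each integer $c \geq 1$, let $P_c(x) = \frac{1}{2^c c!}\left(\frac{d}{dx}\right)^c (x^2-1)^c$ be the $c$th Legendre polynomial, and let $x_{1,c} < x_{2,c} < \cdots < x_{c,c}$ be its $c$ simple roots in $(-1,1)$. For $1 \leq k \leq c$ define $$p_{k,c} = \frac{x_{k,c}+1}{2}, \qquad w_{k,c} = \frac{2}{(1-x_{k,c}^2)^{3/2}\, P_c'(x_{k,c})^2}, \qquad N_c = \sum_{k=1}^c w_{k,c}.$$ Let $\alpha > 0$, and let $k$ satisfy $\alpha c < k < (1-\alpha)c$. Then, as $c \to \infty$, $$p_{k,c} = \sin^2\!\left(\frac{\pi k}{2c}\right) + o(1), \qquad w_{k,c} = \frac{\pi}{c} + o\!\left(\frac{1}{c}\right), \qquad N_c = \pi - o(1).$$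
   Context: The quantities $p_{k,c}$, $w_{k,c}$, $N_c$ are the points, weights and normalizing constant of the discrete (Gauss–Legendre) distribution function $F_{2c-1}(p) = F_{2c}(p) = \frac{1}{N_c}\sum_{k=1}^c w_{k,c} H(p - p_{k,c})$ on $[0,1]$ ($H$ the Heaviside step function), which was shown by Nuida et al. to be the optimal bias distribution (maximizing expected coalition score) in the symmetric Tardos fingerprinting scheme against $2c-1$ or $2c$ colluders. *)

(* Defs.v *)
From HB Require Import structures.
From mathcomp Require Import all_boot all_order all_algebra.
From mathcomp Require Import all_classical all_reals all_analysis.
From mathcomp Require Import polyrcf.
Set Implicit Arguments. Unset Strict Implicit. Unset Printing Implicit Defensive.
Import Order.TTheory GRing.Theory Num.Theory.
Local Open Scope ring_scope.

Section Gauss.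
Variable R : realType.

Definition legendre (c : nat) : {poly R} :=
  ((2 ^ c * c`!)%:R)^-1 *: ((('X ^+ 2 - 1) ^+ c)^`(c)).

(* x_{k,c}: the k-th smallest root (k = 1..c) of P_c in (-1,1);
   roots p a b is the increasingly sorted list of roots of p in ]a,b[. *)
Definition leg_root (k c : nat) : R := nth 0 (roots (legendre c) (-1) 1) k.-1.

Definition p_kc (k c : nat) : R := (leg_root k c + 1) / 2.

Definition w_kc (k c : nat) : R :=
  let x := leg_root k c in
  2 / (powR (1 - x ^+ 2) (3 / 2) * ((legendre c)^`()).[x] ^+ 2).

Definition N_c (c : nat) : R := \sum_(1 <= k < c.+1) w_kc k c.

End Gauss.

(* Main.v *)
Require Import Defs.
From HB Require Import structures.
From mathcomp Require Import all_boot all_order all_algebra.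
From mathcomp Require Import all_classical all_reals all_analysis.
From mathcomp Require Import polyrcf polyorder ring lra zify.
Set Implicit Arguments. Unset Strict Implicit. Unset Printing Implicit Defensive.
Import Order.TTheory GRing.Theory Num.Theory numFieldNormedType.Exports.
Local Open Scope ring_scope.

(* Put x = - cos t and u(t) = sqrt (sin t) P_c(- cos t).  Legendre's equation
   becomes u'' + q u = 0 with q = (c + 1/2)^2 + 1 / (4 sin^2 t).
   Sturm comparison with sin ((c + 1/2) t) shows that each of the c + 1 gaps
   between consecutive points of 0 < t_1 < ... < t_c < pi is at most
   pi / (c + 1/2); these gaps add up to pi, so t_k is within pi / c of k pi / c.
   At a zero, w_{k,c} = 2 / u'(t_k)^2.  The energy E = u'^2 + q u^2 is minimal at
   pi / 2 and E / q is maximal there, so u'(t_k)^2 = E(t_k) lies between E(pi/2)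
   and (q(t_k) / q(pi/2)) E(pi/2), and E(pi/2), an expression in central binomial
   coefficients, is 2c / pi + O(1) by Wallis' inequalities.  In particular
   w_{k,c} <= pi / c for all k, with asymptotic equality in the bulk, whence the
   limit of N_c. *)

(** * Roots of Legendre polynomials, their differential equation, and their values at 0 *)

Section Legendre_polynomial.
Variable R : realType.
Implicit Types (p : {poly R}) (c n k : nat).

(** Rolle's theorem in each gap of an increasing list of roots; the new roots interlace the old
    ones, which gives the order and the bounds. *)
Lemma rolle_path p (a : R) s :
  path <%R a s -> all (root p) (a :: s) ->
  exists s', [/\ size s' = size s, path <%R a s', all (< last a s) s' &
                 all (root p^`()) s'].
Proof.
elim: s a => [|b s IH] a /=; first by move=> _ _; exists [::].
move=> /andP[ab sb] /andP[ra /andP[rb rs]].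
have /IH[|s' [ss' ps' ls' rs']] := sb; first by rewrite /= rb.
have [x /itvP xab rx] : {x | x \in `]a, b[ & p^`().[x] = 0}.
  by apply: poly_rolle => //; rewrite (rootP ra) (rootP rb).
exists (x :: s'); split => /=; first by rewrite ss'.
- rewrite xab /=; case: s' ps' {ss' ls' rs'} => //= y s' /andP[by_ ->].
  by rewrite (lt_trans _ by_) ?xab.
- rewrite ls' andbT (@lt_le_trans _ _ b) ?xab//.
  case: s sb {IH rs ss' ls'} => //= y s /andP[lby pys].
  have /(order_path_min lt_trans)/allP H : path <%R b (y :: s) by rewrite /= lby.
  have := mem_last y s.
  by move=> /H /ltW.
- by rewrite rs' andbT; apply/rootP.
Qed.

Let f c : {poly R} := ('X ^+ 2 - 1) ^+ c.

(** By the product rule, each derivative uses up at most one factor $X^2-1$. *)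
Lemma dvd_derivn_sqB1 c n : (n <= c)%N ->
  exists q : {poly R}, (f c)^`(n) = ('X ^+ 2 - 1) ^+ (c - n) * q.
Proof.
rewrite /f; move: ('X ^+ 2 - 1) => U.
elim: n => [|n IH] nc; first by exists 1; rewrite derivn0 mulr1 subn0.
have [q qE] := IH (ltnW nc).
exists ((c - n)%:R * U^`() * q + U * q^`()).
rewrite derivnS qE derivM deriv_exp -mulr_natl.
have -> : (c - n)%N = (c - n.+1).+1 by rewrite subnSK.
rewrite /= exprS; move: (U ^+ _) (U^`()) (q^`()) (_%:R) => u v w z; ring.
Qed.

(** Induction on [n]: as long as $n < c$, the points $\pm 1$ are still roots of the $n$th
    derivative, so with its $n$ interior roots there are $n+1$ gaps for Rolle's theorem. *)
Lemma derivn_sqB1_roots c n : (n <= c)%N ->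
  exists s, [/\ size s = n, path <%R (-1) s, all (< 1) s &
                all (root (f c)^`(n)) s].
Proof.
elim: n => [|n IH] nc; first by exists [::].
have [s [ss ps ls rs]] := IH (ltnW nc).
have [q qE] := dvd_derivn_sqB1 (ltnW nc).
have r1 x : x ^+ 2 = 1 -> root (f c)^`(n) x.
  move=> x1; rewrite rootE qE !hornerE x1 subrr expr0n.
  by rewrite subn_eq0 leqNgt nc mul0r.
have lts : last (-1) s < 1.
  have : all (< 1) (-1 :: s) by rewrite /= ls (lt_trans (ltrN10 R)).
  by move/allP; apply; exact: mem_last.
have ps1 : path <%R (-1) (rcons s 1) by rewrite rcons_path ps lts.
have [|s' [ss' ps' ls' rs']] := @rolle_path (f c)^`(n) _ _ ps1.
  by rewrite /= all_rcons rs !r1// ?expr1n// sqrrN expr1n.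
exists s'; split => //; first by rewrite ss' size_rcons ss.
by move: ls'; rewrite last_rcons.
Qed.

Lemma size_sqB1 c : size (f c) = (2 * c).+1.
Proof.
have s3 : size ('X ^+ 2 - 1 : {poly R}) = 3%N by rewrite size_XnsubC.
have := size_exp ('X ^+ 2 - 1 : {poly R}) c; rewrite s3 => <-.
by rewrite prednK// lt0n size_poly_eq0 expf_neq0// -size_poly_eq0 s3.
Qed.

Lemma legendre_scale_gt0 c : 0 < ((2 ^ c * c`!)%:R : R)^-1.
Proof. by rewrite invr_gt0 ltr0n muln_gt0 expn_gt0 fact_gt0. Qed.

Lemma size_legendre c : size (legendre R c) = c.+1.
Proof.
rewrite /legendre size_scale ?gt_eqF ?legendre_scale_gt0//.
have H n : size (f c)^`(n) = ((2 * c).+1 - n)%N.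
  elim: n => [|n IH]; first by rewrite derivn0 size_sqB1 subn0.
  by rewrite derivnS size_deriv IH subnS.
by rewrite H mul2n -addnn -addnS addKn.
Qed.

Lemma legendre_neq0 c : legendre R c != 0.
Proof. by rewrite -size_poly_eq0 size_legendre. Qed.

(** At most $c$ roots by the degree, at least $c$ by Rolle. Hence the default value of [nth] in
    [leg_root] is never reached for $1 \le k \le c$. *)
Lemma size_legendre_roots c : size (roots (legendre R c) (-1) 1) = c.
Proof.
apply/eqP; rewrite eqn_leq; apply/andP; split.
  rewrite -ltnS -(size_legendre c) max_poly_roots ?legendre_neq0 ?uniq_roots//.
  by apply/allP => x /root_roots.
have [s [<- ps ls rs]] := derivn_sqB1_roots (leqnn c).
have us : uniq (-1 :: s) by apply: (@sorted_uniq _ <%R) => //; exact: lt_trans.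
apply: uniq_leq_size; first by case/andP: us.
move=> x xs; rewrite -root_is_roots ?legendre_neq0//.
  by rewrite /legendre rootZ ?gt_eqF ?legendre_scale_gt0// (allP rs).
rewrite in_itv/=; apply/andP; split; last exact: (allP ls).
exact: (allP (order_path_min lt_trans ps)).
Qed.

(** With $U = X^2-1$ and $f = U^c$, this is $U f' = 2c X f$ differentiated $n+1$ times; $n = c$
    gives Legendre's equation. *)
Lemma derivn_sqB1_ode c n :
  ('X ^+ 2 - 1) * (f c)^`(n.+2) + (2 * (n%:R + 1 - c%:R)) *: ('X * (f c)^`(n.+1))
   + ((n%:R + 1) * (n%:R - 2 * c%:R)) *: (f c)^`(n) = 0.
Proof.
rewrite /f; have : ('X ^+ 2 - 1 : {poly R})^`() = 2 *: 'X.
  by rewrite derivB derivXn -polyC1 derivC subr0 expr1 scaler_nat.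
move: ('X ^+ 2 - 1) => U dU; elim: n => [|n IH].
  have : U * (U ^+ c)^`() = (2 * c%:R) *: ('X * U ^+ c).
    rewrite deriv_exp dU; case: c => [|c]; first by rewrite mulr0n !mulr0 scale0r.
    rewrite exprS -mulr_natr -!mul_polyC rmorphM/= !polyC_natr.
    by move: (U ^+ c) 'X (c.+1%:R) => u v w; ring.
  move/(congr1 deriv); rewrite derivM derivZ derivM dU derivX -!mul_polyC => /eqP.
  rewrite -subr_eq0 => /eqP <-.
  rewrite derivnS derivn1 derivn0 !(rmorphM, rmorphD, rmorphB, polyC_natr)/=.
  rewrite !polyC1 polyC0.
  by move: ((U ^+ c)^`()^`()) ((U ^+ c)^`()) (U ^+ c) 'X (c%:R) => a b d x y; ring.
move: (congr1 deriv IH).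
rewrite !derivD !derivZ !derivM dU derivX deriv0 -!derivnS -!mul_polyC => <-.
rewrite !(rmorphM, rmorphD, rmorphB, polyC_natr)/= !polyC1 -natr1.
move: ((U ^+ c)^`(n.+3)) ((U ^+ c)^`(n.+2)) ((U ^+ c)^`(n.+1)) ((U ^+ c)^`(n)).
by move: 'X (c%:R) (n%:R) => x y t u v w z; ring.
Qed.

Lemma legendre_ode c :
  (1 - 'X ^+ 2) * (legendre R c)^`()^`() =
  2 *: ('X * (legendre R c)^`()) - (c%:R * (c%:R + 1)) *: legendre R c.
Proof.
have := derivn_sqB1_ode c c; rewrite /legendre !derivZ -!derivnS -/(f c).
move: (_^-1) (_^`(c.+2)) (_^`(c.+1)) (_^`(c)) => k a b d H.
apply/eqP; rewrite -subr_eq0; apply/eqP.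
rewrite -[RHS](mulr0 (- k%:P)) -H -!mul_polyC.
rewrite !(rmorphM, rmorphD, rmorphB, rmorphN, polyC_natr)/= !polyC1.
by move: 'X (c%:R) k%:P => x y z; ring.
Qed.

Lemma legendre_ode_horner c x :
  (1 - x ^+ 2) * (legendre R c)^`()^`().[x] =
  2 * x * (legendre R c)^`().[x] - c%:R * (c%:R + 1) * (legendre R c).[x].
Proof.
have := congr1 (horner^~ x) (legendre_ode c).
by move: (legendre R c) => p; rewrite !hornerE.
Qed.

Lemma coef_sqB1 c k :
  (f c)`_k = \sum_(i < c.+1) (-1) ^+ i * 'C(c, i)%:R * (k == 2 * (c - i))%N%:R.
Proof.
rewrite /f exprBn coef_sum; apply: eq_bigr => i _.
rewrite expr1n mulr1 coefMn -exprM -polyC1 -polyCN -rmorphXn/= coefCM coefXn.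
by rewrite -[LHS]mulr_natr mulrAC.
Qed.

Lemma coef_sqB1_even c m : (m <= c)%N ->
  (f c)`_(2 * m) = (-1) ^+ (c - m) * 'C(c, m)%:R.
Proof.
move=> mc; rewrite coef_sqB1.
have lt : (c - m < c.+1)%N by rewrite ltnS leq_subr.
rewrite (bigD1 (Ordinal lt))//= big1 => [|i neq].
  by rewrite addr0 subKn// eqxx mulr1 bin_sub.
rewrite eqn_pmul2l//; case: eqP => [e|_]; last by rewrite mulr0.
by case/negP: neq; apply/eqP/val_inj => /=; rewrite e subKn// -ltnS.
Qed.

Lemma coef_sqB1_odd c m : (f c)`_(2 * m).+1 = 0.
Proof.
rewrite coef_sqB1 big1// => i _; case: eqP => [e|_]; last by rewrite mulr0.
by have := congr1 odd e; rewrite !mul2n /= !odd_double.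
Qed.

Lemma legendre0 c : (legendre R c).[0] = (f c)`_c / 2 ^+ c.
Proof.
rewrite horner_coef0 /legendre coefZ coef_derivn addn0 ffactnn natrM invfM natrX.
rewrite -[(f c)`_c *+ _]mulr_natr.
have : (c`!%:R : R) != 0 by rewrite pnatr_eq0 -lt0n fact_gt0.
have : (2 ^+ c : R) != 0 by rewrite expf_neq0// pnatr_eq0.
by move: (f c)`_c (2 ^+ c) (c`!%:R) => a b d b0 d0; field; rewrite ?b0 ?d0.
Qed.

Lemma legendre_deriv0 c :
  (legendre R c)^`().[0] = c.+1%:R * (f c)`_c.+1 / 2 ^+ c.
Proof.
rewrite horner_coef0 /legendre derivZ -derivnS coefZ coef_derivn addn0 ffactnn.
rewrite factS !natrM invfM natrX -[(f c)`__ *+ _]mulr_natr natrM.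
have : (c`!%:R : R) != 0 by rewrite pnatr_eq0 -lt0n fact_gt0.
have : (2 ^+ c : R) != 0 by rewrite expf_neq0// pnatr_eq0.
by move: (f c)`_c.+1 (2 ^+ c) (c`!%:R) (c.+1%:R) => a b d e b0 d0; field; rewrite ?b0 ?d0.
Qed.

(** The Wallis ratio $(2m-1)!!/(2m)!!$, of order $1/\sqrt{\pi m}$. *)
Definition central_bin m : R := 'C(2 * m, m)%:R / 4 ^+ m.

Lemma expr2_sign k : ((-1) ^+ k) ^+ 2 = 1 :> R.
Proof. by rewrite -exprM mulnC exprM sqrrN expr1n expr1n. Qed.

(** The values at 0 enter the energy at $\pi/2$ only through their squares, and squaring removes the
    sign $(-1)^{c-m}$ of the coefficient. *)
Lemma legendre_even0 m :
  (legendre R (2 * m)).[0] ^+ 2 = central_bin m ^+ 2 /\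
  (legendre R (2 * m))^`().[0] = 0.
Proof.
rewrite legendre0 legendre_deriv0 coef_sqB1_odd mulr0 mul0r; split => //.
rewrite coef_sqB1_even ?leq_pmull// /central_bin !exprMn expr2_sign mul1r.
by rewrite exprM -natrX.
Qed.

Lemma legendre_odd0 m :
  (legendre R (2 * m).+1)^`().[0] ^+ 2 = ((2 * m.+1)%:R * central_bin m.+1) ^+ 2 /\
  (legendre R (2 * m).+1).[0] = 0.
Proof.
rewrite legendre0 legendre_deriv0 coef_sqB1_odd mul0r; split => //.
rewrite (_ : (2 * m).+2 = 2 * m.+1)%N; last by rewrite !mul2n doubleS.
rewrite coef_sqB1_even; last by rewrite ltnS leq_pmull.
(* This is $\binom{2m+2}{m+1} = 2\binom{2m+1}{m+1}$. *)
have -> : central_bin m.+1 = 'C((2 * m).+1, m.+1)%:R / 2 ^+ (2 * m).+1.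
  rewrite /central_bin (_ : (2 * m.+1)%N = (2 * m).+2); last by rewrite !mul2n doubleS.
  rewrite binS (_ : 'C((2 * m).+1, m) = 'C((2 * m).+1, m.+1)); last first.
    by rewrite -[RHS]bin_sub; [congr 'C(_, _); lia|lia].
  have -> : (2 ^+ (2 * m).+1 : R) = 2 * 4 ^+ m by rewrite exprS exprM -natrX.
  have : (4 ^+ m : R) != 0 by rewrite expf_neq0// pnatr_eq0.
  by rewrite addnn -mul2n natrM exprS; move: (4 ^+ m) => x x0; field.
by rewrite !exprMn expr2_sign mul1r -mulrA.
Qed.

End Legendre_polynomial.

(** * Monotonicity from derivatives, and rules for differentiating explicit functions *)

Section Calculus.
Variable R : realType.
Implicit Types (f df : R -> R) (a b : R).

Lemma MVT_is_derive f df a b : a <= b ->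
  (forall x, a <= x <= b -> is_derive x (1 : R) f (df x)) ->
  exists2 x, a <= x <= b & f b - f a = df x * (b - a).
Proof.
move=> ab fdf; have [||x xab ->] := @MVT_segment R f df a b ab.
- by move=> x; rewrite in_itv/= => /andP[/ltW ax /ltW xb]; apply: fdf; rewrite ax.
- apply: derivable_within_continuous => x; rewrite in_itv/= => xab.
  by have [] := fdf x xab.
- by exists x => //; move: xab; rewrite in_itv.
Qed.

Lemma is_derive_ge0_le f df a b : a <= b ->
  (forall x, a <= x <= b -> is_derive x (1 : R) f (df x)) ->
  (forall x, a <= x <= b -> 0 <= df x) -> f a <= f b.
Proof.
move=> ab fdf df0; have [x xab fE] := MVT_is_derive ab fdf.
by rewrite -subr_ge0 fE mulr_ge0 ?df0// subr_ge0.
Qed.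

Lemma is_derive_le0_ge f df a b : a <= b ->
  (forall x, a <= x <= b -> is_derive x (1 : R) f (df x)) ->
  (forall x, a <= x <= b -> df x <= 0) -> f b <= f a.
Proof.
move=> ab fdf df0; have [x xab fE] := MVT_is_derive ab fdf.
by rewrite -subr_le0 fE mulr_le0_ge0 ?df0// subr_ge0.
Qed.

(** The interval is open because the energy functions below, built from $1/\sin t$, are
    differentiated only on $(0,\pi)$. *)
Lemma min_of_is_derive f df a b m t : a < m < b -> a < t < b ->
  (forall x, a < x < b -> is_derive x (1 : R) f (df x)) ->
  (forall x, a < x <= m -> df x <= 0) ->
  (forall x, m <= x < b -> 0 <= df x) -> f m <= f t.
Proof.
move=> mab tab fdf dfl dfr; have [mt|/ltW tm] := leP m t.
  apply: (is_derive_ge0_le mt) => x xmt; [apply: fdf|apply: dfr]; lra.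
apply: (is_derive_le0_ge tm) => x xmt; [apply: fdf|apply: dfl]; lra.
Qed.

Section pointwise_derivation.
Variables (x : R) (f g : R -> R) (a b : R).
Hypotheses (fa : is_derive x (1 : R) f a) (gb : is_derive x (1 : R) g b).

Lemma is_deriveD_fun : is_derive x (1 : R) (fun t => f t + g t) (a + b).
Proof. exact: is_deriveD. Qed.

Lemma is_deriveN_fun : is_derive x (1 : R) (fun t => - f t) (- a).
Proof. exact: is_deriveN. Qed.

Lemma is_deriveM_fun :
  is_derive x (1 : R) (fun t => f t * g t) (f x * b + g x * a).
Proof. exact: is_deriveM. Qed.

Lemma is_deriveX_fun n :
  is_derive x (1 : R) (fun t => f t ^+ n) (n%:R * f x ^+ n.-1 * a).
Proof.
rewrite (_ : (fun t => f t ^+ n) = f ^+ n); first exact: is_deriveX.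
by apply/funext => t; rewrite exprfctE.
Qed.

Lemma is_deriveV_fun : f x != 0 ->
  is_derive x (1 : R) (fun t => (f t)^-1) (- f x ^- 2 * a).
Proof. by move=> fx0; exact: is_deriveV. Qed.

Lemma is_derive_horner_fun (p : {poly R}) :
  is_derive x (1 : R) (fun t => p.[f t]) (p^`().[f x] * a).
Proof. exact: (is_derive1_comp (is_derive_poly p (f x)) fa). Qed.

Lemma is_derive_atan_fun :
  is_derive x (1 : R) (fun t => atan (f t)) ((1 + f x ^+ 2)^-1 * a).
Proof. exact: (is_derive1_comp (is_derive1_atan (f x)) fa). Qed.

End pointwise_derivation.

Lemma is_derive_cst_fun (k x : R) : is_derive x (1 : R) (fun=> k) 0.
Proof. exact: is_derive_cst. Qed.

Lemma is_derive_id_fun (x : R) : is_derive x (1 : R) (fun t => t) 1.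
Proof. exact: is_derive_id. Qed.

End Calculus.

(** Follows the syntax of the function and leaves nonvanishing denominators as goals. The derivative
    is found by unification, so most calls come under [is_derive_eq]; known derivatives are taken
    from the context. *)
Ltac derive_pointwise := repeat first
  [ eassumption | eapply is_derive_cst_fun | eapply is_derive_id_fun
  | eapply is_derive_sin | eapply is_derive_cos
  | eapply is_deriveD_fun | eapply is_deriveN_fun | eapply is_deriveM_fun
  | eapply is_deriveX_fun | eapply is_deriveV_fun
  | eapply is_derive_horner_fun | eapply is_derive_atan_fun ].

(** * Wallis' inequalities for central binomial coefficients *)

Section Wallis.
Variable R : realType.

(* An antiderivative of [sin ^+ n], so that [I n] below is Wallis' integral of
   [sin ^+ n] over [0, pi / 2] with no integration theory involved. *)
Fixpoint sin_pow_prim n (t : R) : R :=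
  match n with
  | 0 => t
  | 1 => - cos t
  | m.+2 => (m.+1%:R * sin_pow_prim m t - sin t ^+ m.+1 * cos t) / m.+2%:R
  end.

Lemma is_derive_sin_pow_prim n (t : R) :
  is_derive t (1 : R) (sin_pow_prim n) (sin t ^+ n).
Proof.
elim/ltn_ind: n => -[_|[_|n IH]].
- by rewrite expr0; exact: is_derive_id.
- simple eapply is_derive_eq; first (rewrite /=; derive_pointwise).
  by rewrite expr1 opprK.
- have IHn := IH n (ltnW (ltnSn n.+1)).
  simple eapply is_derive_eq; first (rewrite /=; derive_pointwise).
  have := cos2Dsin2 t; have n0 : (n.+2%:R : R) != 0 by rewrite pnatr_eq0.
  rewrite /= !exprS -!natr1 in n0 *.
  move: (sin t ^+ n) (cos t) (sin t) (n%:R) n0 => u c s k k0 cs.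
  have {cs} cs : c ^+ 2 = 1 - s ^+ 2 by lra.
  by field: cs.
Qed.

Let I n := sin_pow_prim n (pi / 2) - sin_pow_prim n 0.

(** The boundary term $\sin^{n+1} t \cos t$ vanishes at both $0$ and $\pi/2$. *)
Lemma wallis_rec n : I n.+2 = n.+1%:R / n.+2%:R * I n.
Proof.
rewrite /I /= cos_pihalf sin_pihalf sin0 cos0 expr0n /=.
have n0 : (n.+2%:R : R) != 0 by rewrite pnatr_eq0.
by field.
Qed.

(** On $[0,\pi/2]$, $\sin^{n+1} \le \sin^n$, so the difference of the two primitives is
    nondecreasing. *)
Lemma wallis_nincr n : I n.+1 <= I n.
Proof.
have p0 : 0 <= pi / 2 :> R by rewrite divr_ge0// pi_ge0.
suff: sin_pow_prim n 0 - sin_pow_prim n.+1 0 <=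
      sin_pow_prim n (pi / 2) - sin_pow_prim n.+1 (pi / 2) by rewrite /I; lra.
apply: (@is_derive_ge0_le _ (fun t => sin_pow_prim n t - sin_pow_prim n.+1 t)
   (fun t => sin t ^+ n - sin t ^+ n.+1) _ _ p0) => x x01.
  have := is_derive_sin_pow_prim n x; have := is_derive_sin_pow_prim n.+1 x.
  by move=> h1 h2; derive_pointwise.
have s0 : 0 <= sin x by rewrite sin_ge0_pi//; have := pi_ge0 R; lra.
by rewrite exprS subr_ge0 ler_piMl ?exprn_ge0 ?sin_le1.
Qed.

Lemma central_bin_rec m :
  (2 * m.+1)%:R * central_bin R m.+1 = (2 * m).+1%:R * central_bin R m.
Proof.
have H : (m.+1 * 'C(2 * m.+1, m.+1) = 2 * ((2 * m).+1 * 'C(2 * m, m)))%N.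
  rewrite (_ : (2 * m.+1)%N = (2 * m).+2); last by rewrite !mul2n doubleS.
  have := mul_bin_diag (2 * m).+2 m; have := mul_bin_diag (2 * m).+1 m.
  rewrite ![_.-1]/=.
  rewrite (_ : 'C((2 * m).+1, m) = 'C((2 * m).+1, m.+1)); last first.
    by rewrite -[RHS]bin_sub; [congr 'C(_, _); lia|lia].
  by nia.
have := congr1 (GRing.natmul (1 : R)) H; rewrite !natrM /central_bin exprS.
have : (4 ^+ m : R) != 0 by rewrite expf_neq0// pnatr_eq0.
move: (4 ^+ m) ('C(_, m)%:R) ('C(_, m.+1)%:R) (m.+1%:R) ((2 * m).+1%:R).
move=> x a b y z x0 e.
by have -> : 2 * y * (b / (4 * x)) = 2 * (y * b) / (4 * x); [field|rewrite e; field].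
Qed.

Lemma wallis_even m : I (2 * m) = pi / 2 * central_bin R m.
Proof.
elim: m => [|m IH].
  by rewrite /I /central_bin muln0 /= subr0 bin0 expr0 divr1 mulr1.
rewrite (_ : (2 * m.+1)%N = (2 * m).+2); last by rewrite !mul2n doubleS.
rewrite wallis_rec IH; have := central_bin_rec m.
rewrite (_ : (2 * m.+1)%N = (2 * m).+2); last by rewrite !mul2n doubleS.
have : ((2 * m).+2%:R : R) != 0 by rewrite pnatr_eq0.
move: ((2 * m).+2%:R) ((2 * m).+1%:R) => x y x0 e.
by rewrite -[central_bin R m.+1](mulKf x0) e; field.
Qed.

(** The two factors obey inverse recurrences, so their product keeps its value at $m = 0$. *)
Lemma wallis_odd m : I (2 * m).+1 * ((2 * m).+1%:R * central_bin R m) = 1.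
Proof.
elim: m => [|m IH].
  by rewrite /I /central_bin muln0 /= bin0 expr0 divr1 cos_pihalf cos0; ring.
rewrite -[RHS]IH -(central_bin_rec m).
rewrite (_ : (2 * m.+1)%N = (2 * m).+2); last by rewrite !mul2n doubleS.
rewrite (wallis_rec (2 * m).+1).
have : ((2 * m).+3%:R : R) != 0 by rewrite pnatr_eq0.
by move: ((2 * m).+3%:R) ((2 * m).+2%:R) => x y x0; field.
Qed.

Lemma central_bin_ge0 m : 0 <= central_bin R m.
Proof. by rewrite divr_ge0// exprn_ge0. Qed.

(** This is $I_{2m+1} \le I_{2m}$ multiplied by $(2m+1)$ [central_bin m], which is the inverse of
    $I_{2m+1}$. *)
Lemma wallis_lower m : 2 <= pi * ((2 * m%:R + 1) * central_bin R m ^+ 2).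
Proof.
rewrite -natrM natr1.
have := wallis_nincr (2 * m); rewrite wallis_even => H.
have h0 : 0 <= (2 * m).+1%:R * central_bin R m by rewrite mulr_ge0// central_bin_ge0.
by have := ler_wpM2r h0 H; rewrite wallis_odd; nra.
Qed.

(** For positive index, this is $I_{2m+2} \le I_{2m+1}$ multiplied by the inverse of $I_{2m+1}$. *)
Lemma wallis_upper m : pi * (2 * m%:R * central_bin R m ^+ 2) <= 2.
Proof.
rewrite -natrM.
case: m => [|m]; first by rewrite muln0 mul0r mulr0.
have := wallis_nincr (2 * m).+1.
rewrite (_ : (2 * m).+2 = 2 * m.+1)%N; last by rewrite !mul2n doubleS.
rewrite wallis_even => H.
have h0 : 0 <= (2 * m).+1%:R * central_bin R m by rewrite mulr_ge0// central_bin_ge0.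
by have := ler_wpM2r h0 H; rewrite wallis_odd -central_bin_rec; nra.
Qed.

End Wallis.

(** * Legendre's equation in the angle: Sturm comparison and monotone energies *)

Section Legendre_ode_theta.
Variables (R : realType) (c : nat).
Implicit Types (t : R).

Definition leg_y t : R := (legendre R c).[- cos t].

(* With [u = sqrt (sin t) * leg_y t], [leg_v] is [u' / sqrt (sin t)]; Legendre's
   equation becomes [u'' = - leg_q * u], of which [leg_energy] below is the energy
   [u' ^+ 2 + leg_q * u ^+ 2]. *)
Definition leg_v t : R :=
  (legendre R c)^`().[- cos t] * sin t + cos t * (2 * sin t)^-1 * leg_y t.

Definition leg_nu : R := c%:R + 2^-1.

Definition leg_q t : R := leg_nu ^+ 2 + (4 * sin t ^+ 2)^-1.

Lemma leg_nu_gt0 : 0 < leg_nu.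
Proof. by rewrite /leg_nu; have := ler0n R c; lra. Qed.

Lemma leg_nu2_gt0 : 0 < leg_nu ^+ 2.
Proof. by rewrite exprn_gt0// leg_nu_gt0. Qed.

Lemma leg_q_ge t : leg_nu ^+ 2 <= leg_q t.
Proof. by rewrite lerDl invr_ge0 mulr_ge0// sqr_ge0. Qed.

Lemma leg_q_gt0 t : 0 < leg_q t.
Proof. exact: lt_le_trans leg_nu2_gt0 (leg_q_ge t). Qed.

(** With [is_derive_leg_v], this writes $u'' = -qu$ as a first-order system in $y = u/\sqrt{\sin t}$
    and $v = u'/\sqrt{\sin t}$, so that no square root is ever differentiated. *)
Lemma is_derive_leg_y t : 0 < t < pi ->
  is_derive t (1 : R) leg_y (leg_v t - cos t * (2 * sin t)^-1 * leg_y t).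
Proof.
move=> t0; rewrite /leg_v addrK.
simple eapply is_derive_eq; first (rewrite /leg_y; derive_pointwise).
by rewrite opprK.
Qed.

Lemma is_derive_leg_v t : 0 < t < pi ->
  is_derive t (1 : R) leg_v
    (- (cos t * (2 * sin t)^-1) * leg_v t - leg_q t * leg_y t).
Proof.
move=> t0; have s0 : sin t != 0 by rewrite gt_eqF// sin_gt0_pi.
have dy := is_derive_leg_y t0.
simple eapply is_derive_eq.
  rewrite /leg_v; derive_pointwise; by rewrite mulf_neq0// pnatr_eq0.
have := legendre_ode_horner c (- cos t).
rewrite /leg_q /leg_v /leg_nu -/(leg_y t) /=.
have := cos2Dsin2 t.
move: ((legendre R c)^`()^`().[_]) ((legendre R c)^`().[_]) (leg_y t).
move: (cos t) (sin t) s0.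
move=> co s s0 p2 p1 y cs ode.
have {}ode : s ^+ 2 * p2 = - (2 * co * p1) - c%:R * (c%:R + 1) * y.
  by rewrite -(addKr (co ^+ 2) (s ^+ 2)) cs addrC -[co ^+ 2]sqrrN ode; ring.
have {}cs : s ^+ 2 = 1 - co ^+ 2 by lra.
have {}ode : p2 = (- (2 * co * p1) - c%:R * (c%:R + 1) * y) / s ^+ 2.
  by rewrite -ode; field.
by rewrite ode; field: cs.
Qed.

(** With $D = 1 + (x/n)^2$, the left side equals $-(q - n^2)/(nD)$. *)
Lemma riccati_phase_le0 (n q x : R) : 0 < n -> n ^+ 2 <= q ->
  (1 + (x / n) ^+ 2)^-1 * ((- q - x ^+ 2) / n) + n <= 0.
Proof.
move=> n0 nq; have n1 : n != 0 by rewrite gt_eqF.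
have D0 : 0 < 1 + (x / n) ^+ 2 by rewrite ltr_wpDr ?sqr_ge0.
have : (- q - x ^+ 2) / n = - ((1 + (x / n) ^+ 2) * n) - (q - n ^+ 2) / n by field.
move: (1 + (x / n) ^+ 2) D0 => D D0 ->.
rewrite mulrBr mulrN mulKf ?gt_eqF// addrAC addNr add0r oppr_le0.
by rewrite mulr_ge0 ?invr_ge0 ?divr_ge0 ?subr_ge0// ltW.
Qed.

(* Sturm comparison through the Riccati variable [r = u' / u]: the phase
   [atan (r / nu) + nu * t] is nonincreasing, while [atan] varies by less than [pi]. *)
Lemma leg_sturm (a b : R) : 0 < a -> a <= b -> b < pi ->
  (forall t, a <= t <= b -> leg_y t != 0) -> leg_nu * (b - a) < pi.
Proof.
move=> a0 ab bpi y0; have nu0 := leg_nu_gt0.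
pose phi (t : R) : R := atan (leg_v t / leg_y t / leg_nu) + leg_nu * t.
suff: phi b <= phi a.
  rewrite /phi; have := atan_ltpi2 (leg_v a / leg_y a / leg_nu).
  by have := atan_gtNpi2 (leg_v b / leg_y b / leg_nu); lra.
pose r (t : R) : R := leg_v t / leg_y t.
pose dphi (t : R) : R :=
  (1 + (r t / leg_nu) ^+ 2)^-1 * ((- leg_q t - r t ^+ 2) / leg_nu) + leg_nu.
apply: (@is_derive_le0_ge _ phi dphi _ _ ab) => t tab.
  have t0 : 0 < t < pi by lra.
  have := is_derive_leg_y t0; have := is_derive_leg_v t0 => dv dy.
  simple eapply is_derive_eq; first (rewrite /phi; derive_pointwise; exact: y0).
  (* The cotangent terms of [dv] and [dy] cancel in the quotient, leaving the Riccati equation $r' =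
     -q - r^2$. *)
  have := y0 t tab; rewrite /dphi /r /=.
  move: (leg_y t) (leg_v t) (leg_q t) (cos t / _) => y v q k yn0.
  by congr (_ * _ + _); field; rewrite ?yn0 ?gt_eqF.
exact: riccati_phase_le0 nu0 (leg_q_ge t).
Qed.

Definition leg_energy t : R :=
  sin t * leg_v t ^+ 2 + leg_q t * (sin t * leg_y t ^+ 2).

Let is_derive_leg_q t : 0 < t < pi ->
  is_derive t (1 : R) leg_q (- (cos t / (2 * sin t ^+ 3))).
Proof.
move=> t0; have s0 : sin t != 0 by rewrite gt_eqF// sin_gt0_pi.
simple eapply is_derive_eq.
  by rewrite /leg_q; derive_pointwise; rewrite mulf_neq0 ?expf_neq0// pnatr_eq0.
by move: (cos t) (sin t) s0 => co s s0 /=; field.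
Qed.

(** By $u'' = -qu$ the terms in $u u'$ cancel, leaving $E' = q' u^2$. *)
Let is_derive_leg_energy t : 0 < t < pi ->
  is_derive t (1 : R) leg_energy (- (cos t / (2 * sin t ^+ 2) * leg_y t ^+ 2)).
Proof.
move=> t0; have s0 : sin t != 0 by rewrite gt_eqF// sin_gt0_pi.
have dq := is_derive_leg_q t0.
have dy := is_derive_leg_y t0; have dv := is_derive_leg_v t0.
simple eapply is_derive_eq; first (rewrite /leg_energy; derive_pointwise).
rewrite /=.
move: (leg_y t) (leg_v t) (leg_q t) (cos t) (sin t) s0.
by move=> y v q co s s0; field.
Qed.

(** Here $E/q = u'^2/q + u^2$; the terms in $u u'$ cancel again, leaving $-q' u'^2/q^2$. *)
Let is_derive_leg_energy_div t : 0 < t < pi ->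
  is_derive t (1 : R) (fun t => leg_energy t / leg_q t)
    (cos t / (2 * sin t ^+ 2) * (leg_v t / leg_q t) ^+ 2).
Proof.
move=> t0; have s0 : sin t != 0 by rewrite gt_eqF// sin_gt0_pi.
have dq := is_derive_leg_q t0; have dE := is_derive_leg_energy t0.
have qn0 : leg_q t != 0 by rewrite gt_eqF// leg_q_gt0.
simple eapply is_derive_eq; first derive_pointwise.
rewrite /leg_energy /=.
 move: (leg_y t) (leg_v t) (leg_q t) (cos t) (sin t) s0 qn0.
by move=> y v q co s s0 q0; field; rewrite ?s0 ?q0.
Qed.

Let half_pi_itv : 0 < (pi / 2 : R) < pi.
Proof. by have := pi_gt0 R; lra. Qed.

Let cos_le0 t : pi / 2 <= t < pi -> cos t <= 0.
Proof.
move=> tp; have := sin_ge0_pi.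
have -> : cos t = - sin (t - pi / 2) by rewrite sinBpihalf opprK.
by move=> h; rewrite oppr_le0 h//; lra.
Qed.

Let cos_ge0 t : 0 < t <= pi / 2 -> 0 <= cos t.
Proof. by move=> tp; apply: cos_ge0_pihalf; have := pi_gt0 R; lra. Qed.

Let coef_ge0 t (x : R) : 0 <= x ^+ 2 / (2 * sin t ^+ 2).
Proof. by rewrite divr_ge0 ?sqr_ge0// mulr_ge0// sqr_ge0. Qed.

(** $E' = q' u^2$ and $q'$ has the sign of $-\cos t$, which changes at $\pi/2$. *)
Lemma leg_energy_ge t : 0 < t < pi -> leg_energy (pi / 2) <= leg_energy t.
Proof.
move=> t0; apply: (min_of_is_derive half_pi_itv t0 is_derive_leg_energy) => x xm.
  by rewrite mulrAC -mulrA oppr_le0 mulr_ge0 ?cos_ge0 ?coef_ge0.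
by rewrite mulrAC -mulrA oppr_ge0 mulr_le0_ge0 ?cos_le0 ?coef_ge0.
Qed.

Lemma leg_energy_div_le t : 0 < t < pi ->
  leg_energy t / leg_q t <= leg_energy (pi / 2) / leg_q (pi / 2).
Proof.
move=> t0; rewrite -lerN2.
apply: (@min_of_is_derive _ (fun t => - (leg_energy t / leg_q t))
   (fun t => - (cos t / (2 * sin t ^+ 2) * (leg_v t / leg_q t) ^+ 2))
   _ _ _ _ half_pi_itv t0) => x xm.
- by have := is_derive_leg_energy_div xm => d; derive_pointwise.
- by rewrite mulrAC -mulrA oppr_le0 mulr_ge0 ?cos_ge0 ?coef_ge0.
- by rewrite mulrAC -mulrA oppr_ge0 mulr_le0_ge0 ?cos_le0 ?coef_ge0.
Qed.

End Legendre_ode_theta.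

(** * Location of the zeros and bounds on the weights *)

Section Legendre_zeros.
Variables (R : realType) (c : nat).
Hypothesis c_gt0 : (0 < c)%N.
Implicit Types (t : R) (k : nat).

Let E0 : R := leg_energy c (pi / 2).

Lemma leg_energy_half_pi : E0 =
  (legendre R c)^`().[0] ^+ 2 + (leg_nu R c ^+ 2 + 4^-1) * (legendre R c).[0] ^+ 2.
Proof.
rewrite /E0 /leg_energy /leg_v /leg_q /leg_y cos_pihalf sin_pihalf oppr0.
by rewrite mul0r mul0r addr0 mulr1 mul1r expr1n mulr1 mul1r.
Qed.

(** By parity only one of $P_c(0)$, $P_c'(0)$ survives in [leg_energy_half_pi], and Wallis'
    inequalities bound its square. *)
Lemma leg_energy_half_pi_bounds : 2 * c%:R <= pi * E0 <= 2 * (c%:R + 2).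
Proof.
rewrite leg_energy_half_pi /leg_nu; have := odd_double_half c; have := pi_gt0 R.
case: (odd c) => /= p0; rewrite -mul2n.
  rewrite add1n => <-; have [-> ->] := legendre_odd0 R c./2.
  have := wallis_lower R c./2.+1; have := wallis_upper R c./2.+1.
  have := ler0n R c./2; rewrite -[(2 * c./2).+1%:R]natr1 !natrM -[c./2.+1%:R]natr1.
  move: (central_bin R _) => a; move: (c./2%:R : R) => m m0 h1 h2.
  have h0 : 0 <= pi * a ^+ 2 by rewrite mulr_ge0 ?pi_ge0// sqr_ge0.
  (* Here $c = 2m+1$, and the lower bound follows from $(2m+1)(2m+3) \le (2m+2)^2$. *)
  have h3 : 0 <= 2 * m + 1 by lra.
  have := ler_wpM2l h3 h2; have h4 : 0 <= 2 * (m + 1) by lra.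
  by have := ler_wpM2l h4 h1 => H1 H2; apply/andP; split; lra.
rewrite add0n => cE; have [m cE'] : exists m, c = (2 * m.+1)%N.
  by exists c./2.-1; rewrite prednK//; move: c_gt0; rewrite -cE; lia.
rewrite cE' {cE cE'}; have [-> ->] := legendre_even0 R m.+1.
have := wallis_lower R m.+1; have := wallis_upper R m.+1.
have := ler0n R m; rewrite natrM -[m.+1%:R]natr1.
move: (central_bin R _) => a; move: (m%:R : R) => {}m m0 h1 h2.
have h0 : 0 <= pi * a ^+ 2 by rewrite mulr_ge0 ?pi_ge0// sqr_ge0.
have h4 : 0 <= 2 * (m + 1) by lra.
have := ler_wpM2l h4 h1; have := ler_wpM2l h4 h2; have := mulr_ge0 m0 h0.
by move=> H1 H2 H3; apply/andP; split; lra.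
Qed.

Let E0_gt0 : 0 < E0.
Proof.
have c0 : (0 : R) < c%:R by rewrite ltr0n.
have /andP[h _] := leg_energy_half_pi_bounds.
by rewrite -(pmulr_rgt0 _ (pi_gt0 R)); lra.
Qed.

(** The endpoints are added so that index $k$ is the $k$th root for $1 \le k \le c$, and the $c+1$
    gaps between the angles fill $[0,\pi]$. *)
Definition leg_pts : seq R := -1 :: rcons (roots (legendre R c) (-1) 1) 1.

Lemma size_leg_pts : size leg_pts = c.+2.
Proof. by rewrite /= size_rcons size_legendre_roots. Qed.

Lemma leg_pts_sorted : sorted <%R leg_pts.
Proof.
by rewrite /= rcons_path path_roots last_roots_le.
Qed.

Lemma nth_leg_pts k : (0 < k <= c)%N -> nth 0 leg_pts k = leg_root R k c.
Proof.
by case: k => [//|k] /= kc; rewrite nth_rcons size_legendre_roots kc.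
Qed.

Lemma ltr_nth_leg_pts j k : (j < c.+2)%N -> (k < c.+2)%N ->
  (nth 0 leg_pts j < nth 0 leg_pts k) = (j < k)%N.
Proof.
by move=> jc kc; rewrite (lt_sorted_ltn_nth 0 leg_pts_sorted) ?inE ?size_leg_pts.
Qed.

Lemma leg_pts_itv k : (k < c.+2)%N -> -1 <= nth 0 leg_pts k <= 1.
Proof.
move=> kc; have n0 : nth 0 leg_pts 0 = -1 by [].
have n1 : nth 0 leg_pts c.+1 = 1.
  by rewrite /= nth_rcons size_legendre_roots ltnn eqxx.
apply/andP; split; first by rewrite -n0 leNgt ltr_nth_leg_pts.
by rewrite -[leRHS]n1 leNgt ltr_nth_leg_pts// -leqNgt -ltnS.
Qed.

Definition leg_angle k : R := acos (- nth 0 leg_pts k).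

Let opp_itv (x : R) : -1 <= x <= 1 -> -1 <= - x <= 1.
Proof. by lra. Qed.

Lemma cos_leg_angle k : (k < c.+2)%N -> - cos (leg_angle k) = nth 0 leg_pts k.
Proof.
by move=> /leg_pts_itv/opp_itv kc; rewrite acosK ?opprK// in_itv.
Qed.

Lemma leg_angle_itv k : (k < c.+2)%N -> 0 <= leg_angle k <= pi.
Proof.
by move=> /leg_pts_itv/opp_itv kc; rewrite acos_ge0 ?acos_lepi.
Qed.

Lemma leg_angle0 : leg_angle 0 = 0.
Proof. by rewrite /leg_angle /= opprK acos1. Qed.

Lemma leg_anglec : leg_angle c.+1 = pi.
Proof.
by rewrite /leg_angle /= nth_rcons size_legendre_roots ltnn eqxx acosN1.
Qed.

Lemma leg_angle_oitv k : (0 < k <= c)%N -> 0 < leg_angle k < pi.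
Proof.
case/andP=> k0 kc; have kc2 : (k < c.+2)%N by rewrite ltnS leqW.
have n0 : nth 0 leg_pts 0 = -1 by [].
have n1 : nth 0 leg_pts c.+1 = 1.
  by rewrite /= nth_rcons size_legendre_roots ltnn eqxx.
have h1 : -1 < nth 0 leg_pts k by rewrite -n0 ltr_nth_leg_pts.
have h2 : nth 0 leg_pts k < 1 by rewrite -n1 ltr_nth_leg_pts.
by rewrite acos_gt0 ?acos_ltpi//; lra.
Qed.

(** A longer gap would contain a closed interval of length $\pi/\nu$ free of zeros, against
    [leg_sturm]. *)
Lemma leg_angle_gap k : (k <= c)%N ->
  leg_nu R c * (leg_angle k.+1 - leg_angle k) <= pi.
Proof.
move=> kc; have nu0 := leg_nu_gt0 R c; rewrite leNgt; apply/negP => gap.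
have kc1 : (k < c.+2)%N by rewrite ltnS leqW.
have kc2 : (k.+1 < c.+2)%N by rewrite ltnS.
have /andP[k0 kpi] := leg_angle_itv kc1.
have /andP[k0' kpi'] := leg_angle_itv kc2.
have := gap; rewrite mulrC -ltr_pdivrMr// => gap'.
(* Trimming the gap by [d] at each end leaves length exactly $\pi/\nu$ and avoids the zeros and the
   singular points $0$ and $\pi$. *)
pose d := (leg_angle k.+1 - leg_angle k - pi / leg_nu R c) / 2.
have pin : 0 < pi / leg_nu R c by rewrite divr_gt0 ?pi_gt0.
have d0 : 0 < d by rewrite /d; lra.
have bad : pi / leg_nu R c = leg_angle k.+1 - d - (leg_angle k + d) by rewrite /d; lra.
suff : leg_nu R c * (leg_angle k.+1 - d - (leg_angle k + d)) < pi.
  by rewrite -bad mulrCA divff ?gt_eqF// mulr1 ltxx.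
apply: leg_sturm => [|||t tab]; [lra|lra|lra|].
apply/negP => /eqP yt0.
have t0 : 0 < t < pi by lra.
have titv : t \in `[0, pi] by rewrite in_itv/=; lra.
have h1 : nth 0 leg_pts k < - cos t.
  rewrite -cos_leg_angle// ltrN2 ltr_cos//; last by rewrite in_itv/= k0.
  by lra.
have h2 : - cos t < nth 0 leg_pts k.+1.
  rewrite -cos_leg_angle// ltrN2 ltr_cos//; last by rewrite in_itv/= k0'.
  by lra.
have /andP[l1 _] := leg_pts_itv kc1; have /andP[_ l2] := leg_pts_itv kc2.
(* A zero there would be a term of the sorted list strictly between two consecutive ones. *)
have : - cos t \in leg_pts.
  rewrite /leg_pts inE mem_rcons inE -root_is_roots ?legendre_neq0//.
    by rewrite -[root _ _]/((legendre R c).[- cos t] == 0) -/(leg_y c t) yt0 eqxx !orbT.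
  by rewrite in_itv/=; lra.
move=> /(nthP 0)[j]; rewrite size_leg_pts => jc jE.
by move: h1 h2; rewrite -jE !ltr_nth_leg_pts// [(j < _)%N]ltnS [(j <= k)%N]leqNgt => ->.
Qed.

Lemma leg_angle_le k : (k <= c.+1)%N -> leg_nu R c * leg_angle k <= k%:R * pi.
Proof.
elim: k => [|k IH] kc; first by rewrite leg_angle0 mulr0 mul0r.
have := leg_angle_gap kc; have := IH (ltnW kc).
by rewrite -natr1; lra.
Qed.

(** Adds up the last $c+1-k$ gaps, by induction on their number counted from $\pi$. *)
Lemma leg_angle_ge k : (k <= c.+1)%N ->
  leg_nu R c * (pi - leg_angle k) <= (c.+1 - k)%:R * pi.
Proof.
move=> kc; rewrite -[in leg_angle k](subKn kc).
have : (c.+1 - k <= c.+1)%N by rewrite leq_subr.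
elim: (c.+1 - k)%N => [|j IH] jc; first by rewrite subn0 leg_anglec subrr mulr0 mul0r.
have := @leg_angle_gap (c.+1 - j.+1)%N; rewrite subSS leq_subr -subSn// => /(_ isT).
by have := IH (ltnW jc); rewrite -natr1; lra.
Qed.

(** The two sums of gaps place the angle between $(k-1/2)\pi/(c+1/2)$ and $k\pi/(c+1/2)$. *)
Lemma leg_angle_approx k : (k <= c)%N -> `|leg_angle k - pi * k%:R / c%:R| <= pi / c%:R.
Proof.
move=> kc; have h1 := leg_angle_le (leqW kc); have h2 := leg_angle_ge (leqW kc).
have c0 : (0 : R) < c%:R by rewrite ltr0n.
have kc' : k%:R <= c%:R :> R by rewrite ler_nat.
have k0 : 0 <= k%:R :> R by [].
have p0 := pi_gt0 R; move: h2; rewrite natrB ?leqW// -natr1.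
move: h1; rewrite /leg_nu; move: (leg_angle k) (k%:R : R) kc' k0 => t x xc x0 h1 h2.
rewrite ler_norml; apply/andP; split.
  have : 0 <= c%:R * (t + (pi - pi * x) / c%:R); last first.
    by rewrite pmulr_rge0// mulrBl; lra.
  rewrite mulrDr [X in _ + X]mulrC divfK ?gt_eqF//; nra.
have : c%:R * (t - (pi + pi * x) / c%:R) <= 0; last first.
  by rewrite pmulr_rle0// mulrDl; lra.
rewrite mulrBr [X in _ - X]mulrC divfK ?gt_eqF//; nra.
Qed.

(** At a zero the energy reduces to $\sin^3 t \, P_c'(x)^2$, and $(1-x^2)^{3/2} = \sin^3 t$ because
    $\sin t > 0$. *)
Lemma w_kc_energy k : (0 < k <= c)%N -> w_kc R k c = 2 / leg_energy c (leg_angle k).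
Proof.
move=> kc; have kc2 : (k < c.+2)%N by lia.
have t0 := leg_angle_oitv kc; have s0 := sin_gt0_pi t0.
have yt0 : leg_y c (leg_angle k) = 0.
  rewrite /leg_y cos_leg_angle// nth_leg_pts//; apply/rootP/(@root_roots _ _ (-1) 1).
  by apply: mem_nth; rewrite size_legendre_roots; lia.
rewrite /w_kc -nth_leg_pts// -cos_leg_angle// /leg_energy yt0 /leg_v yt0.
rewrite expr0n/= !mulr0 !addr0 sqrrN -sin2cos2.
rewrite -(powR_mulrn 2 (ltW s0)) -powRrM (_ : 2%:R * (3 / 2) = 3%:R); last by lra.
by rewrite powR_mulrn ?ltW//; congr (2 / _); ring.
Qed.

Lemma w_kc_ge0 k : (0 < k <= c)%N -> 0 <= w_kc R k c.
Proof.
move=> kc; rewrite w_kc_energy// divr_ge0// ltW//.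
exact: lt_le_trans E0_gt0 (leg_energy_ge _ (leg_angle_oitv kc)).
Qed.

Lemma w_kc_le k : (0 < k <= c)%N -> c%:R * w_kc R k c <= pi.
Proof.
move=> kc; have h := leg_energy_ge c (leg_angle_oitv kc); rewrite w_kc_energy//.
have e0 := lt_le_trans E0_gt0 h; rewrite mulrA ler_pdivrMr// mulrC.
have /andP[b _] := leg_energy_half_pi_bounds; apply: (le_trans b).
by rewrite ler_pM2l ?pi_gt0.
Qed.

(** [B] bounds the variable part of $q$ at the zero, so $E \le E_0 (1 + B/\nu^2)$ with $\nu^2 \ge
    c$, while $\pi E_0 \le 2(c+2)$. *)
Lemma w_kc_ge k (B : R) : (0 < k <= c)%N ->
  (4 * sin (leg_angle k) ^+ 2)^-1 <= B -> pi - c%:R * w_kc R k c <= pi * (2 + B) / c%:R.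
Proof.
move=> kc hB; have t0 := leg_angle_oitv kc; have h := leg_energy_div_le c t0.
have E1 : 0 < leg_energy c (leg_angle k) := lt_le_trans E0_gt0 (leg_energy_ge _ t0).
have c0 : (0 : R) < c%:R by rewrite ltr0n.
have c1 : (1 : R) <= c%:R by rewrite ler1n.
have /andP[_ b] := leg_energy_half_pi_bounds.
have nu2 := leg_nu2_gt0 R c; have nuc : c%:R <= leg_nu R c ^+ 2 by rewrite /leg_nu expr2; nra.
have q0 : leg_nu R c ^+ 2 <= leg_q c (pi / 2) by exact: leg_q_ge.
have qB : leg_q c (leg_angle k) <= leg_nu R c ^+ 2 + B by rewrite lerD2l.
have qt0 := leg_q_gt0 c (leg_angle k).
have qh0 := leg_q_gt0 c (pi / 2 : R).
have B0 : 0 <= B by apply: le_trans hB; rewrite invr_ge0 mulr_ge0// sqr_ge0.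
rewrite w_kc_energy//.
move: h b; rewrite -/E0.
move: E1 qB q0 qt0 qh0 nuc nu2; move: E0_gt0.
move: (leg_energy c (leg_angle k)) (leg_q c (leg_angle k)) (leg_q c (pi / 2)).
move: E0 (leg_nu R c ^+ 2) => e0 n e q p e0_gt0 e_gt0 qB nq q_gt0 p_gt0 nuc n_gt0.
rewrite ler_pdivrMr// mulrAC ler_pdivlMr// => h b.
have en : e * n <= e0 * (n + B).
  apply: le_trans (le_trans h _); first by rewrite ler_pM2l.
  by rewrite ler_pM2l.
suff H : pi * (c%:R - (2 + B)) / c%:R <= c%:R * (2 / e).
  by move: H; rewrite mulrBr mulrBl mulfK ?gt_eqF//; lra.
rewrite ler_pdivrMr// [c%:R * _]mulrA mulrAC ler_pdivlMr//.
(* If $c \le 2 + B$, the left side is nonpositive. *)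
have [le0|gt0] := leP (c%:R - (2 + B)) 0.
  apply: (@le_trans _ _ 0); last by rewrite !mulr_ge0// ltW.
  by rewrite mulr_le0_ge0 ?mulr_ge0_le0 ?pi_ge0// ltW.
rewrite -(ler_pM2r n_gt0).
have h1 : pi * e * n <= 2 * (c%:R + 2) * (n + B).
  apply: (@le_trans _ _ (pi * e0 * (n + B))); last by rewrite ler_wpM2r// addr_ge0// ltW.
  by rewrite -!mulrA ler_pM2l ?pi_gt0.
have h2 := ler_wpM2r (ltW gt0) h1.
apply: (@le_trans _ _ (pi * e * n * (c%:R - (2 + B)))).
  by rewrite le_eqVlt; apply/orP; left; apply/eqP; ring.
apply: (le_trans h2) => {hB h1 h2 en qB b c1}.
move: (c%:R : R) B B0 c0 nuc gt0 n_gt0 => x b0 b0_ge0 x0 xn gt0' n0.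
(* Right side minus left side is $2(4n + 4b + b(n(x+2) - x^2) + b^2(x+2))$, with $b$ for [b0]; the
   third term is nonnegative because $n \ge x$. *)
have hB : 0 <= b0 * (n * (x + 2) - x * x) by apply: mulr_ge0 => //; nra.
have hB2 : 0 <= b0 * b0 * (x + 2) by rewrite !mulr_ge0//; lra.
nra.
Qed.

(** The angle lies in $[\alpha\pi/2, \pi - \alpha\pi/2]$. The condition on $c$ is what
    $(k-1/2)\pi/(c+1/2) \ge \alpha\pi/2$ requires when $k > \alpha c$. *)
Lemma sin_leg_angle_bulk (alpha : R) k : 0 < alpha -> 1 + alpha / 2 <= alpha * c%:R ->
  alpha * c%:R < k%:R < (1 - alpha) * c%:R ->
  sin (alpha * pi / 2) ^+ 2 <= sin (leg_angle k) ^+ 2.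
Proof.
move=> al0 al1 /andP[k1 k2]; have c0 : (0 : R) < c%:R by rewrite ltr0n.
have kc : (k <= c)%N by rewrite -(ler_nat R); nra.
have h1 := leg_angle_le (leqW kc); have h2 := leg_angle_ge (leqW kc).
have p0 := pi_gt0 R; have nu0 := leg_nu_gt0 R c.
have alh : alpha < 1 / 2 by nra.
have t0 : alpha * pi / 2 <= leg_angle k.
  rewrite -(ler_pM2l nu0); move: h2; rewrite natrB ?leqW// -natr1 /leg_nu.
  by move: (leg_angle k) (k%:R : R) k1 k2 {h1} => t x k1 k2 h2; nra.
have t1 : leg_angle k <= pi - alpha * pi / 2.
  rewrite -(ler_pM2l nu0) (le_trans h1)// /leg_nu.
  by move: (k%:R : R) k1 k2 {h1 h2} => x k1 k2; nra.
have api : 0 < alpha * pi by rewrite mulr_gt0.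
have api2 : alpha * pi < pi / 2 by nra.
have itv (x : R) : 0 <= x <= pi -> x \in `[0, pi] by rewrite in_itv.
have c1 : cos (leg_angle k) <= cos (alpha * pi / 2).
  by rewrite leNgt ltr_cos -?leNgt// itv; lra.
have c2 : - cos (alpha * pi / 2) <= cos (leg_angle k).
  have -> : - cos (alpha * pi / 2) = cos (pi - alpha * pi / 2).
    by rewrite cosB cospi sinpi; ring.
  by rewrite leNgt ltr_cos -?leNgt// itv; lra.
rewrite !sin2cos2 lerD2l lerN2.
by move: (cos _) (cos _) c1 c2 => x y *; nra.
Qed.


End Legendre_zeros.

(** * Passage to the limit *)

Section limits.
Variable R : realType.

Lemma cos_lipschitz (x y : R) : `|cos x - cos y| <= `|x - y|.
Proof.
wlog xy : x y / x <= y => [H|].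
  by have [/H//|/ltW/H] := leP x y; rewrite distrC [leRHS]distrC.
rewrite distrC [leRHS]distrC.
have [z _ ->] := MVT_is_derive xy (fun z _ => is_derive_cos z).
by rewrite normrM normrN ler_piMl// sin_max.
Qed.

Lemma sin_sqr_half (x : R) : sin (x / 2) ^+ 2 = (1 - cos x) / 2.
Proof.
rewrite {2}(_ : x = (x / 2) *+ 2); last by rewrite -mulr_natr divfK// pnatr_eq0.
by rewrite cos_mulr2n sin2cos2 -mulr_natr; field.
Qed.

(** Both terms have the form $(1 - \cos s)/2$, with $s$ the angle of the zero and $s = \pi k/c$, and
    cosine is 1-Lipschitz. *)
Lemma p_kc_approx (c k : nat) : (0 < k <= c)%N ->
  `|p_kc R k c - sin (pi * k%:R / (2 * c%:R)) ^+ 2| <= pi / c%:R.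
Proof.
move=> kc; have c0 : (0 < c)%N by lia.
rewrite invfM [2^-1 * _]mulrC mulrA sin_sqr_half /p_kc -nth_leg_pts//.
rewrite -cos_leg_angle//; last lia.
have := leg_angle_approx R c0 (proj2 (andP kc)).
have := cos_lipschitz (leg_angle R c k) (pi * k%:R / c%:R).
move: (pi / c%:R) (leg_angle R c k) (_ * _ / c%:R) => e t x h1 h2.
have := le_trans h1 h2; rewrite !ler_norml => /andP[h3 h4].
have := le_trans (normr_ge0 _) h2 => e0.
by apply/andP; split; lra.
Qed.

Lemma ltr_div_trunc (a e : R) (c : nat) : 0 < e ->
  ((Num.trunc (a / e)).+1 <= c)%N -> a < e * c%:R.
Proof.
move=> e0 h; rewrite mulrC -ltr_pdivrMr//; apply: (lt_le_trans (truncnS_gt _)).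
by rewrite ler_nat.
Qed.

Lemma bulk_range (alpha : R) (c k : nat) : 0 < alpha ->
  alpha * c%:R < k%:R < (1 - alpha) * c%:R -> (0 < k <= c)%N.
Proof.
move=> al0 /andP[k1 k2]; have c0 := ler0n R c.
apply/andP; split; first by rewrite -(ltr0n R); nra.
by rewrite -(ler_nat R); nra.
Qed.

Lemma c_w_kc_cvg (alpha eps : R) : 0 < alpha -> 0 < eps ->
  exists C : nat, forall c k : nat, (C <= c)%N ->
    alpha * c%:R < k%:R < (1 - alpha) * c%:R -> `|c%:R * w_kc R k c - pi| < eps.
Proof.
move=> al0 eps0; pose B := (4 * sin (alpha * pi / 2) ^+ 2)^-1.
(* The first threshold meets the condition of [sin_leg_angle_bulk]; the second makes the error
   $\pi(2+B)/c$ of [w_kc_ge] less than [eps]. *)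
exists (maxn (Num.trunc ((1 + alpha / 2) / alpha)).+1
             (Num.trunc (pi * (2 + B) / eps)).+1) => c k.
rewrite geq_max => /andP[/(ltr_div_trunc al0) h1 /(ltr_div_trunc eps0) h2] kc.
have kc' := bulk_range al0 kc; have c0 : (0 < c)%N by lia.
have c0' : 0 < c%:R :> R by rewrite ltr0n.
rewrite distrC ger0_norm ?subr_ge0 ?w_kc_le//.
apply: (@le_lt_trans _ _ (pi * (2 + B) / c%:R)); last by rewrite ltr_pdivrMr.
apply: w_kc_ge => //; rewrite /B lef_pV2 ?posrE.
- by rewrite ler_pM2l// (sin_leg_angle_bulk c0 al0 (ltW h1)).
- by rewrite mulr_gt0// exprn_gt0// sin_gt0_pi// leg_angle_oitv.
(* A nonempty bulk forces $\alpha < 1$, whence $\sin(\alpha\pi/2) > 0$. *)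
- have al1 : alpha < 1 by case/andP: kc => k1 k2; nra.
  have p0 := pi_gt0 R; have ap : 0 < alpha * pi by rewrite mulr_gt0.
  have ap1 : alpha * pi < pi by rewrite gtr_pMl.
  by rewrite mulr_gt0// exprn_gt0// sin_gt0_pi//; lra.
Qed.

(** The nonnegative terms at the two edges are dropped; $c + 1 - 2m$ indices remain. *)
Lemma sum_nat_ge_mid (w : nat -> R) (a : R) (m c : nat) :
  (0 < m)%N -> (m + m <= c)%N -> (forall k, (0 < k <= c)%N -> 0 <= w k) ->
  (forall k, (m <= k)%N -> (k + m <= c)%N -> a <= w k) ->
  a *+ (c.+1 - (m + m)) <= \sum_(1 <= k < c.+1) w k.
Proof.
move=> m0 mc w0 wa.
rewrite (@big_cat_nat _ _ _ m)/=; [|lia|lia].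
rewrite (@big_cat_nat _ _ _ (c.+1 - m) m c.+1)/=; [|lia|lia].
rewrite subnDA -sumr_const_nat -[leLHS]add0r lerD//.
  by rewrite big_nat sumr_ge0// => k km; rewrite w0//; lia.
rewrite -[leLHS]addr0 lerD//; last first.
  by rewrite big_nat sumr_ge0// => k km; rewrite w0//; lia.
by rewrite [leLHS]big_nat [leRHS]big_nat ler_sum// => k km; rewrite wa//; lia.
Qed.

Lemma N_c_cvg : (N_c R @ \oo --> (pi : R))%classic.
Proof.
apply/cvgrPdist_lt => eps eps0.
have p0 := pi_gt0 R; have p4 : pi < 4 :> R by have := pihalf_lt2 R; lra.
(* The bound $1/4$ keeps $2m \le c$ below; $\epsilon/32$ makes the dropped edges cost about
   $2\pi\alpha < 8\alpha \le \epsilon/4$. *)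
pose alpha := Num.min (4^-1) (eps / 32) : R.
have al0 : 0 < alpha by rewrite lt_min; apply/andP; split; lra.
have [al1 al2] : alpha <= 4^-1 /\ alpha <= eps / 32 by split; rewrite ge_min lexx ?orbT.
have eps4 : 0 < eps / 4 by lra.
have [C HC] := c_w_kc_cvg al0 eps4.
(* [C] brings the bulk weights within $\epsilon/4$ of $\pi$ after scaling by $c$; $4$ serves $2m \le
   c$; $16/\epsilon$ absorbs the rounding of $\alpha c$ up to $m$, which costs at most $8/c <
   \epsilon/2$. *)
exists (maxn C (maxn 4 (Num.trunc (16 / eps)).+1)) => // c /=.
rewrite !geq_max => /andP[cC /andP[c4 /(ltr_div_trunc eps0) ce]].
have c0 : (0 < c)%N by lia.
have c0' : 0 < c%:R :> R by rewrite ltr0n.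
have c4' : 4 <= c%:R :> R by rewrite (ler_nat R 4).
have ac0 : 0 <= alpha * c%:R by rewrite mulr_ge0// ltW.
have [m [m0 m1 m2]] : exists m : nat,
    [/\ (0 < m)%N, alpha * c%:R < m%:R & m%:R <= alpha * c%:R + 1].
  exists (Num.trunc (alpha * c%:R)).+1; have /andP[h1 h2] := truncn_itv ac0.
  by rewrite h2 -natr1 lerD2r.
have mc : (m + m <= c)%N by rewrite -(ler_nat R) natrD; nra.
(* Every weight is at most $\pi/c$, edges included, so only a lower bound on the sum remains to be
   found. *)
have up : N_c R c <= pi.
  rewrite /N_c (@le_trans _ _ (\sum_(1 <= k < c.+1) (pi / c%:R)))//.
    rewrite big_nat [leRHS]big_nat ler_sum// => k /andP[k0 kc].
    by rewrite ler_pdivlMr// mulrC w_kc_le// k0.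
  by rewrite sumr_const_nat subn1 /= -[_ / _ *+ _]mulr_natr divfK// gt_eqF.
have lo : (pi - eps / 4) / c%:R *+ (c.+1 - (m + m)) <= N_c R c.
  apply: (sum_nat_ge_mid m0 mc) => [k kc|k k0 kc]; first exact: w_kc_ge0.
  have k0' : m%:R <= k%:R :> R by rewrite ler_nat.
  have km' : k%:R + m%:R <= c%:R :> R by rewrite -natrD ler_nat.
  have kk : alpha * c%:R < k%:R < (1 - alpha) * c%:R by lra.
  have := HC c k cC kk; rewrite ltr_norml ler_pdivrMr// mulrC => /andP[h1 _].
  by rewrite mulrC; lra.
rewrite ger0_norm ?subr_ge0//; move: lo.
rewrite -[_ / _ *+ _]mulr_natr natrB ?leqW// natrD -[c.+1%:R]natr1 mulrAC.
rewrite ler_pdivrMr// => lo.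
have M1 : 1 <= m%:R :> R by rewrite ler1n.
have h1 : alpha * c%:R <= eps / 32 * c%:R by rewrite ler_pM2r.
have h2 : pi * m%:R <= 4 * m%:R :> R by rewrite ler_pM2r ?ltr0n// ltW.
have h3 : eps <= eps * m%:R by rewrite ler_pMr.
rewrite -(ltr_pM2l c0'); move: (N_c R c) lo => N lo.
by move: (m%:R : R) (c%:R : R) h1 h2 h3 lo ce m1 m2 => M x *; lra.
Qed.

End limits.

(** The threshold is chosen before [k], so the error terms are uniform over the bulk; the $o(1/c)$
    for the weights is scaled by $c$. *)
Theorem theorem1 (R : realType) (alpha : R) : 0 < alpha ->
  [/\ (forall eps : R, 0 < eps -> exists C : nat, forall c k : nat, (C <= c)%N ->
         alpha * c%:R < k%:R < (1 - alpha) * c%:R ->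
         `| p_kc R k c - (sin (pi * k%:R / (2 * c%:R))) ^+ 2 | < eps),
      (forall eps : R, 0 < eps -> exists C : nat, forall c k : nat, (C <= c)%N ->
         alpha * c%:R < k%:R < (1 - alpha) * c%:R ->
         `| c%:R * w_kc R k c - pi | < eps)
    & (N_c R @ \oo --> (pi : R))%classic].
Proof.
move=> al0; split=> [eps eps0|eps eps0|]; last exact: N_c_cvg.
  exists (Num.trunc (pi / eps)).+1 => c k /(ltr_div_trunc eps0) h kc.
  have kc' := bulk_range al0 kc; have c0 : (0 < c)%N by lia.
  by rewrite (le_lt_trans (p_kc_approx R kc'))// ltr_pdivrMr// ltr0n.
exact: c_w_kc_cvg.
Qed.
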